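(* Let $\pi \colon R \to S$ be a semiring homomorphism. (1) The extension functor $\pi_\# = -\otimes_R S \colon \mathcal{M}_R \to \mathcal{M}_S$ sends strongly projective right $R$-semimodules to strongly projective right $S$-semimodules, and finitely generated strongly projective right $R$-semimodules to finitely generated strongly projective right $S$-semimodules. (2) The restriction functor $\pi^\# \colon \mathcal{M}_S \to \mathcal{M}_R$ sends strongly projective right $S$-semimodules to strongly projective right $R$-semimodules if and only if $\pi^\#(S)$ is a strongly projective right $R$-semimodule; likewise, $\pi^\#$ sends finitely generated strongly projective right $S$-semimodules to finitely generated strongly projective right $R$-semimodules if and only if $\pi^\#(S)$ is a finitely generated strongly projective right $R$-semimodule.
   Context: A semiring $(S,+,\cdot,0,1)$ consists of a commutative monoid $(S,+,0)$ and a monoid $(S,\cdot,1)$ such that multiplication distributes over addition on both sides and $0s=0=s0$; semiring homomorphisms preserve $+,\cdot,0,1$. Right semimodules over $S$ are commutative monoids with a unital, biadditive, associative right action of $S$ with $0_Ms=0_M=m0$; $\mathcal{M}_S$ is the category of right $S$-semimodules. A right $S$-semimodule is (finitely generated) strongly projective if it is isomorphic to a direct summand of a (finitely generated) free right $S$-semimodule, where free semimodules are direct sums of copies of $S_S$. For a semiring homomorphism $\pi\colon R\to S$, the restriction functor $\pi^\#$ views a right $S$-semimodule $B$ as a right $R$-semimodule via $b\cdot r := b\,\pi(r)$ (in particular $\pi^\#(S)$ is $S_S$ viewed as a right $R$-semimodule). The tensor product $A\otimes_R B$ of a right $R$-semimodule $A$ and a left $R$-semimodule $B$ is the quotient of the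 free commutative monoid on $A\times B$ by the congruence generated by the pairs $\langle(a_1+a_2,b),(a_1,b)+(a_2,b)\rangle$, $\langle(a,b_1+b_2),(a,b_1)+(a,b_2)\rangle$, $\langle(ar,b),(a,rb)\rangle$. The extension functor is $\pi_\#=-\otimes_R S$, with $S$ regarded as an $R$-$S$-bisemimodule via $\pi$.
   Formalization: The congruence defining the tensor product is also generated by the pairs ⟨(0,b),0⟩ and ⟨(a,0),0⟩; without them the empty sum differs from a⊗0, so m0 = 0 fails and A⊗_R S is not an S-semimodule. *)

(* Defs.v *)
From HB Require Import structures.
From mathcomp Require Import all_boot all_algebra.
From mathcomp Require Import finmap multiset.
From mathcomp Require Import boolp.
Set Implicit Arguments. Unset Strict Implicit. Unset Printing Implicit Defensive.
Import GRing.Theory.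
Local Open Scope quotient_scope.
Local Open Scope ring_scope.

(* A right R-semimodule is a left semimodule over the converse semiring R^c:
   for r : R^c, [r *: m] is m r.  The mixin of [lSemiModType] has no field for
   0_M s = 0_M, which is derivable ([scaler0]). *)
Notation rSemiModType R := (lSemiModType R^c).

(* S_S, the semiring S as a right semimodule over itself: [s *: x] is x s. *)
Notation rregular S := (S^c)^o.

(** Isomorphisms, direct sums, free and strongly projective semimodules.
    T is the converse of the acting semiring for right semimodules. *)

Section StronglyProjective.
Variable T : pzSemiRingType.

Definition isomorphic (M N : lSemiModType T) : Prop :=
  exists f : {linear M -> N}, bijective f.

Definition direct_sum (I : choiceType) (M : lSemiModType T) : Type :=
  {fsfun I -> M with 0}.

Section DirectSum.
Variables (I : choiceType) (M : lSemiModType T).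
Local Notation D := (direct_sum I M).

HB.instance Definition _ := Choice.on D.

Definition direct_sum_zero : D := [fsfun].
Definition direct_sum_add (f g : D) : D :=
  [fsfun i in (finsupp f `|` finsupp g)%fset => f i + g i].
Definition direct_sum_scale (a : T) (f : D) : D :=
  [fsfun i in finsupp f => a *: f i].

Lemma direct_sum_zeroE i : direct_sum_zero i = 0.
Proof. by rewrite /direct_sum_zero fsfunE. Qed.

Lemma direct_sum_addE f g i : direct_sum_add f g i = f i + g i.
Proof.
rewrite /direct_sum_add fsfunE inE; case: (finsuppP f i) => [fi|//].
by case: (finsuppP g i) => [gi|//]; rewrite addr0.
Qed.

Lemma direct_sum_scaleE a f i : direct_sum_scale a f i = a *: f i.
Proof.
by rewrite /direct_sum_scale fsfunE; case: finsuppP => // _; rewrite scaler0.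
Qed.

Let dsE := (direct_sum_zeroE, direct_sum_addE, direct_sum_scaleE).

Fact direct_sum_addA : associative direct_sum_add.
Proof. by move=> f g h; apply/fsfunP => i; rewrite !dsE addrA. Qed.
Fact direct_sum_addC : commutative direct_sum_add.
Proof. by move=> f g; apply/fsfunP => i; rewrite !dsE addrC. Qed.
Fact direct_sum_add0 : left_id direct_sum_zero direct_sum_add.
Proof. by move=> f; apply/fsfunP => i; rewrite !dsE add0r. Qed.

HB.instance Definition _ :=
  GRing.isNmodule.Build D direct_sum_addA direct_sum_addC direct_sum_add0.

Fact direct_sum_scaleA a b f :
  direct_sum_scale a (direct_sum_scale b f) = direct_sum_scale (a * b) f.
Proof. by apply/fsfunP => i; rewrite !dsE scalerA. Qed.
Fact direct_sum_scale0 f : direct_sum_scale 0 f = 0.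
Proof. by apply/fsfunP => i; rewrite [RHS]direct_sum_zeroE !dsE scale0r. Qed.
Fact direct_sum_scale1 : left_id 1 direct_sum_scale.
Proof. by move=> f; apply/fsfunP => i; rewrite !dsE scale1r. Qed.
Fact direct_sum_scaleDr : right_distributive direct_sum_scale +%R.
Proof.
move=> a f g; apply/fsfunP => i.
by rewrite dsE [RHS]direct_sum_addE !dsE scalerDr.
Qed.
Fact direct_sum_scaleDl f : {morph direct_sum_scale^~ f : a b / a + b}.
Proof.
move=> a b; apply/fsfunP => i.
by rewrite [RHS]direct_sum_addE !dsE scalerDl.
Qed.

HB.instance Definition _ := GRing.Nmodule_isLSemiModule.Build T D
  direct_sum_scaleA direct_sum_scale0 direct_sum_scale1
  direct_sum_scaleDr direct_sum_scaleDl.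

End DirectSum.

Definition is_free (F : lSemiModType T) : Prop :=
  exists I : choiceType, isomorphic F (direct_sum I T^o).

Definition finitely_generated (M : lSemiModType T) : Prop :=
  exists (n : nat) (g : 'I_n -> M),
    forall x : M, exists c : 'I_n -> T, x = \sum_(i < n) c i *: g i.

(* M is isomorphic to a direct summand of F, i.e. F is a direct sum of a copy
   of M and some N. *)
Definition iso_direct_summand (M F : lSemiModType T) : Prop :=
  exists N : lSemiModType T, isomorphic (M * N)%type F.

Definition strongly_projective (M : lSemiModType T) : Prop :=
  exists2 F : lSemiModType T, is_free F & iso_direct_summand M F.

Definition fg_strongly_projective (M : lSemiModType T) : Prop :=
  exists2 F : lSemiModType T,
    is_free F /\ finitely_generated F & iso_direct_summand M F.

End StronglyProjective.

(** Restriction of scalars *)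

Definition restrict (R S : pzSemiRingType) (pi : {rmorphism R -> S})
  (B : lSemiModType S) : Type := B.

Section Restrict.
Variables (R S : pzSemiRingType) (pi : {rmorphism R -> S}).
Variable B : lSemiModType S.
Local Notation pB := (restrict pi B).

HB.instance Definition _ := GRing.Nmodule.on pB.

Definition restrict_scale (r : R) (b : pB) : pB := pi r *: (b : B).

Fact restrict_scaleA a b v :
  restrict_scale a (restrict_scale b v) = restrict_scale (a * b) v.
Proof. by rewrite /restrict_scale scalerA rmorphM. Qed.
Fact restrict_scale0 v : restrict_scale 0 v = 0.
Proof. by rewrite /restrict_scale rmorph0 scale0r. Qed.
Fact restrict_scale1 : left_id 1 restrict_scale.
Proof. by move=> v; rewrite /restrict_scale rmorph1 scale1r. Qed.
Fact restrict_scaleDr : right_distributive restrict_scale +%R.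
Proof. by move=> a u v; rewrite /restrict_scale scalerDr. Qed.
Fact restrict_scaleDl v : {morph restrict_scale^~ v : a b / a + b}.
Proof. by move=> a b; rewrite /restrict_scale rmorphD scalerDl. Qed.

HB.instance Definition _ := GRing.Nmodule_isLSemiModule.Build R pB
  restrict_scaleA restrict_scale0 restrict_scale1
  restrict_scaleDr restrict_scaleDl.

End Restrict.

Section Converse.
Variables (R S : pzSemiRingType) (pi : {rmorphism R -> S}).

Definition rmorph_converse (r : R^c) : S^c := pi r.

Fact rmorph_converse_is_nmod_morphism : nmod_morphism rmorph_converse.
Proof. by split; [exact: (rmorph0 pi)|exact: (rmorphD pi)]. Qed.
Fact rmorph_converse_is_monoid_morphism : monoid_morphism rmorph_converse.
Proof. by split; [exact: (rmorph1 pi)|move=> a b; exact: (rmorphM pi)]. Qed.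

HB.instance Definition _ :=
  GRing.isNmodMorphism.Build R^c S^c rmorph_converse
    rmorph_converse_is_nmod_morphism.
HB.instance Definition _ :=
  GRing.isMonoidMorphism.Build R^c S^c rmorph_converse
    rmorph_converse_is_monoid_morphism.

End Converse.

(* pi^# : b r := b (pi r) *)
Notation restriction pi B := (restrict (rmorph_converse pi) B).

(** Tensor product *)

Section Tensor.
Variables (R : pzSemiRingType) (A : rSemiModType R) (B : lSemiModType R).
Local Open Scope mset_scope.

(* The congruence on the free commutative monoid on A x B (finite multisets)
   generated by the defining pairs of the tensor product.  Without the pairs
   ((0, b), 0) and ((a, 0), 0) the empty multiset would only be congruent to
   itself, all (0, b) and (a, 0) being identified to another element that is
   neutral for nonempty sums; then (a (x) s) 0 = 0 would fail in A (x) S. *)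
Inductive tensor_cong : {mset (A * B)%type} -> {mset (A * B)%type} -> Prop :=
| tensor_Dl a1 a2 b :
    tensor_cong [mset ((a1 + a2)%R, b)] ([mset (a1, b)] `+` [mset (a2, b)])
| tensor_Dr a b1 b2 :
    tensor_cong [mset (a, (b1 + b2)%R)] ([mset (a, b1)] `+` [mset (a, b2)])
| tensor_bal a (r : R) b :
    tensor_cong [mset (((r : R^c) *: a)%R, b)] [mset (a, (r *: b)%R)]
| tensor_0l b : tensor_cong [mset (0%R, b)] mset0
| tensor_0r a : tensor_cong [mset (a, 0%R)] mset0
| tensor_refl u : tensor_cong u u
| tensor_sym u v : tensor_cong u v -> tensor_cong v u
| tensor_trans v u w : tensor_cong u v -> tensor_cong v w -> tensor_cong u w
| tensor_add u v u' v' : tensor_cong u v -> tensor_cong u' v' ->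
    tensor_cong (u `+` u') (v `+` v').

Definition tensor_rel : rel {mset (A * B)%type} :=
  fun u v => `[< tensor_cong u v >].

Fact tensor_rel_equiv : equiv_class_of tensor_rel.
Proof.
split => [u|u v|v u w].
- exact/asboolP/tensor_refl.
- by apply/asboolP/asboolP; apply: tensor_sym.
- by move=> /asboolP uv /asboolP vw; apply/asboolP/(tensor_trans uv vw).
Qed.

Canonical tensor_equiv := EquivRelPack tensor_rel_equiv.

Definition tensor : Type := {eq_quot tensor_equiv}.

HB.instance Definition _ := Choice.on tensor.
HB.instance Definition _ := EqQuotient.on tensor.

Lemma tensor_piP u v :
  \pi_tensor u = \pi_tensor v <-> tensor_cong u v.
Proof. by split=> [/eqmodP/asboolP //|uv]; apply/eqmodP/asboolP. Qed.

Lemma tensorW (P : tensor -> Prop) :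
  (forall u, P (\pi_tensor u)) -> forall x, P x.
Proof. by move=> Ppi x; rewrite -[x]reprK. Qed.

Definition tensor_zero : tensor := \pi_tensor mset0.
Definition tensor_plus (x y : tensor) : tensor := \pi_tensor (repr x `+` repr y).

Lemma tensor_plusE u v :
  tensor_plus (\pi_tensor u) (\pi_tensor v) = \pi_tensor (u `+` v).
Proof. by apply/tensor_piP/tensor_add; apply/tensor_piP; rewrite reprK. Qed.

Fact tensor_plusA : associative tensor_plus.
Proof.
elim/tensorW=> u; elim/tensorW=> v; elim/tensorW=> w.
by rewrite !tensor_plusE msetDA.
Qed.
Fact tensor_plusC : commutative tensor_plus.
Proof. by move=> x y; rewrite /tensor_plus msetDC. Qed.
Fact tensor_plus0 : left_id tensor_zero tensor_plus.
Proof. by elim/tensorW=> u; rewrite tensor_plusE mset0D. Qed.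

HB.instance Definition _ :=
  GRing.isNmodule.Build tensor tensor_plusA tensor_plusC tensor_plus0.

Definition tens (a : A) (b : B) : tensor := \pi_tensor [mset (a, b)].

Local Open Scope ring_scope.

Lemma tensDl a1 a2 b : tens (a1 + a2) b = tens a1 b + tens a2 b.
Proof. by rewrite [RHS]tensor_plusE; apply/tensor_piP/tensor_Dl. Qed.
Lemma tensDr a b1 b2 : tens a (b1 + b2) = tens a b1 + tens a b2.
Proof. by rewrite [RHS]tensor_plusE; apply/tensor_piP/tensor_Dr. Qed.
Lemma tens_bal a (r : R) b : tens ((r : R^c) *: a) b = tens a (r *: b).
Proof. exact/tensor_piP/tensor_bal. Qed.
Lemma tens0l b : tens 0 b = 0.
Proof. exact/tensor_piP/tensor_0l. Qed.
Lemma tens0r a : tens a 0 = 0.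
Proof. exact/tensor_piP/tensor_0r. Qed.

Lemma tensor_piE u : \pi_tensor u = \sum_(p <- u) tens p.1 p.2.
Proof.
rewrite -[u in LHS]seq_mset_id; elim: (u : seq _) => [|[a b] s IHs].
  rewrite big_nil; congr (\pi_tensor _).
  by apply/msetP => x; rewrite mset_seqE mset0E.
by rewrite mset_cons big_cons -IHs; symmetry; apply: tensor_plusE.
Qed.

Lemma tensor_ind (P : tensor -> Prop) :
  P 0 -> (forall x y, P x -> P y -> P (x + y)) -> (forall a b, P (tens a b)) ->
  forall x, P x.
Proof.
move=> P0 PD Pt; elim/tensorW=> u; rewrite tensor_piE.
by elim/big_ind: _ => // p _; apply: Pt.
Qed.

Section Lift.
Variables (V : nmodType) (f : A -> B -> V).
Hypothesis fDl : forall a1 a2 b, f (a1 + a2) b = f a1 b + f a2 b.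
Hypothesis fDr : forall a b1 b2, f a (b1 + b2) = f a b1 + f a b2.
Hypothesis f_bal : forall a (r : R) b, f ((r : R^c) *: a) b = f a (r *: b).
Hypothesis f0l : forall b, f 0 b = 0.
Hypothesis f0r : forall a, f a 0 = 0.

Definition tensor_lift (x : tensor) : V :=
  \sum_(p <- (repr x : {mset (A * B)%type})) f p.1 p.2.

Lemma tensor_lift_pi u :
  tensor_lift (\pi_tensor u) = \sum_(p <- (u : {mset (A * B)%type})) f p.1 p.2.
Proof.
have sum1 p : \sum_(q <- ([mset p] : {mset (A * B)%type})) f q.1 q.2 = f p.1 p.2.
  by rewrite enum_msetn big_seq1.
have sumD (v w : {mset (A * B)%type}) :
    \sum_(p <- (v `+` w)%mset) f p.1 p.2 =
    \sum_(p <- v) f p.1 p.2 + \sum_(p <- w) f p.1 p.2.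
  rewrite -big_cat; apply: perm_big; apply/allP => x _ /=.
  by rewrite count_cat !count_mem_mset msetE2.
have: tensor_cong (repr (\pi_tensor u)) u by apply/tensor_piP; rewrite reprK.
rewrite /tensor_lift; move: (repr _) => w; elim=> {w u} //=.
- by move=> a1 a2 b; rewrite sumD !sum1 /= fDl.
- by move=> a b1 b2; rewrite sumD !sum1 /= fDr.
- by move=> a r b; rewrite !sum1 /= f_bal.
- by move=> b; rewrite sum1 /= f0l enum_mset0 big_nil.
- by move=> a; rewrite sum1 /= f0r enum_mset0 big_nil.
- by move=> v u w _ -> _ ->.
- by move=> u v u' v' _ e _ e'; rewrite !sumD e e'.
Qed.

Lemma tensor_lift_tens a b : tensor_lift (tens a b) = f a b.
Proof. by rewrite tensor_lift_pi enum_msetn big_seq1. Qed.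

Lemma tensor_lift0 : tensor_lift 0 = 0.
Proof. by rewrite -(tens0l 0) tensor_lift_tens f0l. Qed.

Lemma tensor_liftD : {morph tensor_lift : x y / x + y}.
Proof.
elim/tensorW=> u; elim/tensorW=> v; rewrite [_ + _ in LHS]tensor_plusE.
rewrite !tensor_lift_pi -big_cat; apply: perm_big; apply/allP => x _ /=.
by rewrite count_cat !count_mem_mset msetE2.
Qed.

End Lift.
End Tensor.

(** Extension of scalars.  [restrict pi S^o] is S as a left R-semimodule:
    r s := (pi r) s. *)

Definition extension (R S : pzSemiRingType) (pi : {rmorphism R -> S})
  (A : rSemiModType R) : Type := tensor A (restrict pi S^o).

Section Extension.
Variables (R S : pzSemiRingType) (pi : {rmorphism R -> S}).
Variable A : rSemiModType R.
Local Notation E := (extension pi A).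
Local Notation tensE := (@tens R A (restrict pi S^o)).

HB.instance Definition _ := GRing.Nmodule.on E.

(* (a (x) s) t := a (x) (s t), extended additively. *)
Definition extension_scale (t : S^c) (x : E) : E :=
  tensor_lift (fun a (s : restrict pi S^o) =>
    tensE a ((s : S) * (t : S) : S)) x.

Lemma extension_scale_tens t a (s : S) :
  extension_scale t (tensE a s) = tensE a (s * (t : S) : S).
Proof.
rewrite /extension_scale tensor_lift_tens //.
- by move=> *; rewrite tensDl.
- by move=> b s1 s2; rewrite -tensDr; congr tens; apply: mulrDl.
- by move=> b r s1; rewrite tens_bal; congr tens; apply: mulrA.
- by move=> *; rewrite tens0l.
- by move=> b; rewrite -[RHS](tens0r _ b); congr tens; apply: mul0r.
Qed.

Fact extension_scaleD t : {morph extension_scale t : x y / x + y}.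
Proof.
apply: tensor_liftD.
- by move=> *; rewrite tensDl.
- by move=> b s1 s2; rewrite -tensDr; congr tens; apply: mulrDl.
- by move=> b r s1; rewrite tens_bal; congr tens; apply: mulrA.
- by move=> *; rewrite tens0l.
- by move=> b; rewrite -[RHS](tens0r _ b); congr tens; apply: mul0r.
Qed.

Fact extension_scalex0 t : extension_scale t 0 = 0.
Proof.
rewrite -[X in extension_scale t X](tens0l _ 0).
by rewrite extension_scale_tens; apply: tens0l.
Qed.

Lemma extension_ind (P : E -> Prop) :
  P 0 -> (forall x y, P x -> P y -> P (x + y)) ->
  (forall a (s : S), P (tensE a s)) -> forall x, P x.
Proof. exact: tensor_ind. Qed.

Fact extension_scaleA a b x :
  extension_scale a (extension_scale b x) = extension_scale (a * b) x.
Proof.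
elim/extension_ind: x => [|x y ex ey|m s]; first by rewrite !extension_scalex0.
- by rewrite !extension_scaleD ex ey.
- by rewrite !extension_scale_tens; congr tens; rewrite -mulrA.
Qed.
Fact extension_scale0 x : extension_scale 0 x = 0.
Proof.
elim/extension_ind: x => [|x y ex ey|m s]; first by rewrite extension_scalex0.
- by rewrite extension_scaleD ex ey addr0.
- rewrite extension_scale_tens -[RHS](tens0r _ m); congr tens; exact: mulr0.
Qed.
Fact extension_scale1 : left_id 1 extension_scale.
Proof.
move=> x; elim/extension_ind: x => [|x y ex ey|m s].
- by rewrite extension_scalex0.
- by rewrite extension_scaleD ex ey.
- by rewrite extension_scale_tens; congr tens; apply: mulr1.
Qed.
Fact extension_scaleDl x : {morph extension_scale^~ x : a b / a + b}.
Proof.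
move=> a b; elim/extension_ind: x => [|x y ex ey|m s].
- by rewrite !extension_scalex0 addr0.
- by rewrite !extension_scaleD ex ey addrACA.
- by rewrite !extension_scale_tens -[RHS]tensDr; congr tens; apply: mulrDr.
Qed.

HB.instance Definition _ := GRing.Nmodule_isLSemiModule.Build S^c E
  extension_scaleA extension_scale0 extension_scale1
  extension_scaleD extension_scaleDl.

End Extension.

(* Main.v *)
Require Import Defs.
From HB Require Import structures.
From mathcomp Require Import all_boot all_algebra.
From mathcomp Require Import finmap.
Set Implicit Arguments. Unset Strict Implicit. Unset Printing Implicit Defensive.
Import GRing.Theory.
Local Open Scope ring_scope.

(** Extension and restriction of scalars and [direct_sum I] are additive
    functors, so they preserve the biproduct equations that say that M is a
    direct summand of F.  Extension sends the free semimodule on I over R to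
    the one on I over S, with the images of finitely many generators as
    generators.  If B is a summand of a direct sum of I copies of S and
    [pi^# S] is a summand of a free G, then [pi^# B] is a summand of a direct
    sum of I copies of [pi^# S], hence of a direct sum of I copies of G.  In
    the finitely generated case I can be replaced by a finite set. *)

Section Semilinear.
Variables (T : pzSemiRingType) (M N : lSemiModType T) (f : M -> N).
Hypothesis f_lin : semilinear f.
(** The proof of semilinearity is an argument of this copy of [f], so that the linear structure can
    be inferred from the term itself. *)
Definition linear_of of semilinear f := f.
HB.instance Definition _ :=
  GRing.isSemilinear.Build T M N _ (linear_of f_lin) f_lin.
End Semilinear.

(** * Isomorphisms and direct summands *)

Section Isomorphic.
Variable T : pzSemiRingType.
Implicit Types M N P F G : lSemiModType T.

Lemma isomorphicP M N : isomorphic M N <->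
  exists (f : {linear M -> N}) (g : {linear N -> M}), cancel f g /\ cancel g f.
Proof.
split=> [[f [g fK gK]]|[f [g [fK gK]]]]; last by exists f; exists g.
by exists f, (linear_of (can2_semilinear fK gK)).
Qed.

Lemma isomorphic_trans N M P :
  isomorphic M N -> isomorphic N P -> isomorphic M P.
Proof. by case=> f fb [g gb]; exists (g \o f); apply: bij_comp. Qed.

Definition biproduct M N F (i1 : {linear M -> F}) (p1 : {linear F -> M})
    (i2 : {linear N -> F}) (p2 : {linear F -> N}) : Prop :=
  [/\ cancel i1 p1, cancel i2 p2, forall x, p2 (i1 x) = 0,
      forall y, p1 (i2 y) = 0 & forall z, i1 (p1 z) + i2 (p2 z) = z].

(* Over a semiring a retract need not have a complement, so both summands are
   kept: these equations are preserved by every additive functor. *)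
Lemma iso_direct_summandP M F : iso_direct_summand M F <->
  exists N (i1 : {linear M -> F}) (p1 : {linear F -> M})
    (i2 : {linear N -> F}) (p2 : {linear F -> N}), biproduct i1 p1 i2 p2.
Proof.
split=> [[N /isomorphicP[f [g [fK gK]]]]|[N [i1 [p1 [i2 [p2 []]]]]]].
  have inl_lin : semilinear (fun x : M => (x, 0 : N)).
    by split=> [a x|x y]; apply/pair_equal_spec; rewrite ?scaler0 ?addr0.
  have inr_lin : semilinear (fun y : N => (0 : M, y)).
    by split=> [a x|x y]; apply/pair_equal_spec; rewrite ?scaler0 ?addr0.
  exists N, (f \o linear_of inl_lin), (fst \o g),
    (f \o linear_of inr_lin), (snd \o g).
  split=> z; rewrite /= ?fK //= -linearD -[RHS]gK; congr (f _).
  by rewrite /linear_of; case: (g z) => x y; congr pair; rewrite ?addr0 ?add0r.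
move=> e11 e22 e21 e12 e.
have f_lin : semilinear (fun z : M * N => i1 z.1 + i2 z.2).
  split=> [a x|x y]; first by rewrite /= !linearZ scalerDr.
  by rewrite /= !linearD addrACA.
exists N, (linear_of f_lin); exists (fun z => (p1 z, p2 z)) => [[x y]|z].
  by rewrite /linear_of !linearD e11 e21 e12 e22 addr0 add0r.
exact: e.
Qed.

(** If F = M + N and G = F + N', then N + N' is a complement of [M] in [G]. *)
Lemma iso_direct_summand_trans F M G : iso_direct_summand M F ->
  iso_direct_summand F G -> iso_direct_summand M G.
Proof.
move=> /iso_direct_summandP[N [i1 [p1 [i2 [p2 [e11 e22 e21 e12 e]]]]]].
move=> /iso_direct_summandP[N' [j1 [q1 [j2 [q2 [d11 d22 d21 d12 d]]]]]].
have j_lin : semilinear (fun z : N * N' => j1 (i2 z.1) + j2 z.2).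
  split=> [a x|x y]; first by rewrite /= !linearZ scalerDr.
  by rewrite /= !linearD addrACA.
have q_lin : semilinear (fun z => (p2 (q1 z), q2 z) : N * N').
  by split=> [a x|x y]; rewrite ?linearZ ?linearD.
apply/iso_direct_summandP; exists (N * N')%type, (j1 \o i1), (p1 \o q1).
exists (linear_of j_lin), (linear_of q_lin).
split=> [x|[y y']|x|[y y']|z]; rewrite /= /linear_of /=.
- by rewrite d11 e11.
- by rewrite !linearD d11 e22 d12 d21 d22 linear0 addr0 add0r.
- by rewrite d11 d21 e21.
- by rewrite linearD d11 d12 addr0 e12.
- by rewrite addrA -linearD e d.
Qed.

End Isomorphic.

(** * Direct sums *)

Section DirectSum.
Variables (T : pzSemiRingType) (I : choiceType) (M : lSemiModType T).
Local Notation D := (direct_sum I M).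

Lemma direct_sumD (f g : D) i : (f + g) i = f i + g i.
Proof. exact: direct_sum_addE. Qed.

Lemma direct_sumZ a (f : D) i : (a *: f) i = a *: f i.
Proof. exact: direct_sum_scaleE. Qed.

Lemma direct_sum0 i : (0 : D) i = 0.
Proof. exact: direct_sum_zeroE. Qed.

Definition direct_sum_in_fun (i : I) (m : M) : D :=
  [fsfun j in [fset i]%fset => m].

Lemma direct_sum_in_funE i m j :
  direct_sum_in_fun i m j = if j == i then m else 0.
Proof. by rewrite fsfunE inE. Qed.

Fact direct_sum_in_lin i : semilinear (direct_sum_in_fun i).
Proof.
split=> [a x|x y]; apply/fsfunP => j.
  by rewrite direct_sumZ !direct_sum_in_funE; case: eqP; rewrite ?scaler0.
by rewrite direct_sumD !direct_sum_in_funE; case: eqP; rewrite ?addr0.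
Qed.

Definition direct_sum_in i : {linear M -> D} := linear_of (direct_sum_in_lin i).

Lemma direct_sum_inE i m j : direct_sum_in i m j = if j == i then m else 0.
Proof. exact: direct_sum_in_funE. Qed.

(** Evaluation at [j] is additive, so the equation can be checked index by index, where at most the
    term i = j survives. *)
Lemma direct_sum_decomp (f : D) :
  f = \sum_(i <- finsupp f) direct_sum_in i (f i).
Proof.
apply/fsfunP => j; rewrite (big_morph (fun g : D => g j) (id1 := 0) (op1 := +%R)).
- rewrite (eq_bigr (fun i => if i == j then f i else 0)) => [|i _]; last first.
    by rewrite direct_sum_inE eq_sym.
  rewrite -big_mkcond /=; case: finsuppP => [fj|fj].
    rewrite big1_seq // => i /andP[/eqP-> ij].
    by move: fj; rewrite ij.
  by rewrite -big_filter filter_pred1_uniq ?big_seq1.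
- by move=> *; rewrite direct_sumD.
- exact: direct_sum0.
Qed.

Lemma direct_sum_ind (P : D -> Prop) :
  P 0 -> (forall f g, P f -> P g -> P (f + g)) ->
  (forall i m, P (direct_sum_in i m)) -> forall f, P f.
Proof.
move=> P0 PD Pi f; rewrite (direct_sum_decomp f).
by elim/big_ind: _ => // i _.
Qed.

(** * Maps out of a direct sum: its universal property as a coproduct *)

Section Out.
Variables (N : lSemiModType T) (phi : I -> {linear M -> N}).

Definition direct_sum_out_fun (f : D) : N :=
  \sum_(i <- finsupp f) phi i (f i).

(** The support of [a *: f] or [f + g] can be smaller than the supports of [f] and [g]; linearity is
    therefore proved by comparing sums over a common larger set [K]. *)
Lemma direct_sum_out_fun_sub (K : {fset I}) (f : D) : (finsupp f `<=` K)%fset ->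
  direct_sum_out_fun f = \sum_(i <- K) phi i (f i).
Proof.
move=> fK; apply: big_fset_incl => // i _ /fsfun_dflt ->; exact: linear0.
Qed.

Fact direct_sum_out_lin : semilinear direct_sum_out_fun.
Proof.
split=> [a f|f g].
  rewrite (@direct_sum_out_fun_sub (finsupp f)) ?scaler_sumr.
    by apply: eq_bigr => i _; rewrite direct_sumZ linearZ.
  apply/fsubsetP => i; apply: contraLR => /fsfun_dflt fi.
  by rewrite memNfinsupp direct_sumZ fi scaler0.
pose K := (finsupp f `|` finsupp g)%fset.
rewrite !(@direct_sum_out_fun_sub K) ?fsubsetUl ?fsubsetUr //.
  rewrite -big_split; apply: eq_bigr => i _ /=.
  by rewrite direct_sumD linearD.
apply/fsubsetP => i; apply: contraLR.
rewrite inE negb_or => /andP[/fsfun_dflt fi /fsfun_dflt gi].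
by rewrite memNfinsupp direct_sumD fi gi addr0.
Qed.

Definition direct_sum_out : {linear D -> N} := linear_of direct_sum_out_lin.

Lemma direct_sum_out_in i m : direct_sum_out (direct_sum_in i m) = phi i m.
Proof.
rewrite [LHS](@direct_sum_out_fun_sub [fset i]%fset).
  by rewrite big_seq_fset1 direct_sum_inE eqxx.
apply/fsubsetP => j; rewrite mem_finsupp direct_sum_inE inE.
by case: (j == i); rewrite ?eqxx.
Qed.

End Out.

(** The uniqueness half of the universal property. Identities between linear maps, written as
    composites and sums, are reduced by it to single summands. *)
Lemma direct_sum_linear_eq (N : lSemiModType T) (u v : {linear D -> N}) :
  (forall i m, u (direct_sum_in i m) = v (direct_sum_in i m)) -> u =1 v.
Proof.
move=> uv f; elim/direct_sum_ind: f => [|f g ef eg|//]; first by rewrite !linear0.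
by rewrite !linearD ef eg.
Qed.

End DirectSum.

(** * Functoriality of direct sums over a fixed index set *)

Section DirectSumMap.
Variables (T : pzSemiRingType) (I : choiceType).
Implicit Types M N : lSemiModType T.

Definition direct_sum_map M N (h : {linear M -> N}) :
    {linear direct_sum I M -> direct_sum I N} :=
  direct_sum_out (fun i => direct_sum_in N i \o h).

Lemma direct_sum_map_in M N (h : {linear M -> N}) i m :
  direct_sum_map h (direct_sum_in M i m) = direct_sum_in N i (h m).
Proof. exact: direct_sum_out_in. Qed.

Lemma direct_sum_mapK M N (h : {linear M -> N}) (k : {linear N -> M}) :
  cancel h k -> cancel (direct_sum_map h) (direct_sum_map k).
Proof.
move=> hK; apply: (@direct_sum_linear_eq _ _ _ _ (_ \o _) idfun) => i m.
by rewrite /= !direct_sum_map_in hK.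
Qed.

Lemma isomorphic_direct_sum M N : isomorphic M N ->
  isomorphic (direct_sum I M) (direct_sum I N).
Proof.
case/isomorphicP=> h [k [hK kK]]; apply/isomorphicP.
by exists (direct_sum_map h), (direct_sum_map k); split; apply: direct_sum_mapK.
Qed.

(** Each of the five biproduct equations is an equality of linear maps, so it follows summand by
    summand from the one for [F]. *)
Lemma iso_direct_summand_direct_sum M F : iso_direct_summand M F ->
  iso_direct_summand (direct_sum I M) (direct_sum I F).
Proof.
case/iso_direct_summandP=> N [i1 [p1 [i2 [p2 [e11 e22 e21 e12 e]]]]].
apply/iso_direct_summandP; exists (direct_sum I N), (direct_sum_map i1),
  (direct_sum_map p1), (direct_sum_map i2), (direct_sum_map p2).
split; try exact: direct_sum_mapK.
- apply: (@direct_sum_linear_eq _ _ _ _ (_ \o _) \0) => i m.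
  by rewrite /= !direct_sum_map_in e21 linear0.
- apply: (@direct_sum_linear_eq _ _ _ _ (_ \o _) \0) => i m.
  by rewrite /= !direct_sum_map_in e12 linear0.
- apply: (@direct_sum_linear_eq _ _ _ _ ((_ \o _) \+ (_ \o _)) idfun) => i m.
  by rewrite /= !direct_sum_map_in -linearD e.
Qed.

End DirectSumMap.

Lemma iso_direct_summand_isomorphic (T : pzSemiRingType) (M N : lSemiModType T) :
  isomorphic M N -> iso_direct_summand M N.
Proof.
case/isomorphicP=> f [g [fK gK]]; apply/iso_direct_summandP.
(* The complement is the zero semimodule, realised as an empty direct sum. *)
exists (direct_sum void N), f, g, \0, \0; split=> // [z|y|z].
- by apply/fsfunP => [[]].
- exact: linear0.
- by rewrite /= gK addr0.
Qed.

(** Both maps come from the universal property and match the summand [j] inside the summand [i] with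
    the summand [(i, j)]. *)
Lemma isomorphic_direct_sum_direct_sum (T : pzSemiRingType) (I J : choiceType)
    (M : lSemiModType T) :
  isomorphic (direct_sum I (direct_sum J M)) (direct_sum (I * J)%type M).
Proof.
pose u (i : I) := direct_sum_out (fun j : J => direct_sum_in M (i, j)).
pose v (ij : I * J) :=
  direct_sum_in (direct_sum J M) ij.1 \o direct_sum_in M ij.2.
apply/isomorphicP; exists (direct_sum_out u), (direct_sum_out v); split.
  apply: (@direct_sum_linear_eq _ _ _ _ (_ \o _) idfun) => i.
  rewrite /= => f; rewrite direct_sum_out_in.
  (* For fixed [i] both sides are again linear in [f], so uniqueness applies a second time, to the
     inner sum. *)
  apply: (@direct_sum_linear_eq _ _ _ _ (_ \o _) (direct_sum_in _ i)) => j m.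
  by rewrite /= /u !direct_sum_out_in.
apply: (@direct_sum_linear_eq _ _ _ _ (_ \o _) idfun) => [[i j] m].
by rewrite /= direct_sum_out_in /v /= direct_sum_out_in /u direct_sum_out_in.
Qed.

(** * Finite generation *)

Section Span.
Variable T : pzSemiRingType.
Implicit Types M N : lSemiModType T.

(** Any finite type may index the generators, so that products and [unit] serve as index sets
    without renumbering. *)
Definition in_span M (X : finType) (g : X -> M) (x : M) : Prop :=
  exists c : X -> T, x = \sum_i c i *: g i.

Section InSpan.
Variables (M : lSemiModType T) (X : finType) (g : X -> M).

Lemma in_span0 : in_span g 0.
Proof. by exists (fun=> 0); rewrite big1 // => i _; rewrite scale0r. Qed.

Lemma in_spanD x y : in_span g x -> in_span g y -> in_span g (x + y).
Proof.
move=> [c ->] [d ->]; exists (fun i => c i + d i).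
by rewrite -big_split; apply: eq_bigr => i _; rewrite scalerDl.
Qed.

Lemma in_spanZ a x : in_span g x -> in_span g (a *: x).
Proof.
move=> [c ->]; exists (fun i => a * c i).
by rewrite scaler_sumr; apply: eq_bigr => i _; rewrite scalerA.
Qed.

Lemma in_span_gen i : in_span g (g i).
Proof.
exists (fun j => if j == i then 1 else 0).
rewrite (bigD1 i) //= eqxx scale1r big1 ?addr0 // => j /negPf->.
exact: scale0r.
Qed.

Lemma in_span_linear N (Y : finType) (h : Y -> N) (f : {linear N -> M}) y :
  (forall i, in_span g (f (h i))) -> in_span h y -> in_span g (f y).
Proof.
move=> fh [c ->]; rewrite linear_sum; apply: (big_ind (in_span g)).
- exact: in_span0.
- exact: in_spanD.
- by move=> i _; rewrite linearZ; apply: in_spanZ.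
Qed.

End InSpan.

Lemma finitely_generatedP M : finitely_generated M <->
  exists (X : finType) (g : X -> M), forall x, in_span g x.
Proof.
split=> [[n [g gP]]|[X [g gP]]]; first by exists 'I_n, g.
exists #|X|, (g \o enum_val) => x; have [c ->] := gP x.
exists (c \o enum_val); rewrite (reindex_onto enum_val enum_rank) /=.
  by apply: eq_bigl => i; rewrite enum_valK eqxx.
by move=> i _; rewrite enum_rankK.
Qed.

Lemma finitely_generated_image M N (f : {linear M -> N}) :
  (forall y, exists x, f x = y) -> finitely_generated M -> finitely_generated N.
Proof.
move=> f_surj /finitely_generatedP[X [g gP]]; apply/finitely_generatedP.
exists X, (f \o g) => y; have [x <-] := f_surj y.
by apply: in_span_linear (gP x) => i; apply: (in_span_gen (f \o g)).
Qed.

Lemma finitely_generated_isomorphic M N :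
  isomorphic M N -> finitely_generated M -> finitely_generated N.
Proof.
by case=> f [g _ gK]; apply: (@finitely_generated_image _ _ f) => y; exists (g y).
Qed.

Lemma finitely_generated_direct_sum (K : finType) M :
  finitely_generated M -> finitely_generated (direct_sum K M).
Proof.
move=> /finitely_generatedP[X [g gP]]; apply/finitely_generatedP.
pose h (kx : K * X) := direct_sum_in M kx.1 (g kx.2).
exists (K * X)%type, h; elim/direct_sum_ind => [|x y|k m].
- exact: in_span0.
- exact: in_spanD.
- by apply: in_span_linear (gP m) => x; apply: (in_span_gen h (k, x)).
Qed.

Lemma finitely_generated_regular : finitely_generated T^o.
Proof.
apply/finitely_generatedP; exists unit, (fun=> 1) => x.
by exists (fun=> x); rewrite big_const card_unit /= addr0; symmetry; apply: mulr1.
Qed.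

(* Every element is supported in the union K of the supports of finitely many
   generators, so that the summands outside K vanish (over the zero semiring
   I itself may be infinite). *)
Lemma finitely_generated_direct_sum_fset (I : choiceType) M :
  finitely_generated (direct_sum I M) ->
  exists K : {fset I}, isomorphic (direct_sum I M) (direct_sum K M).
Proof.
move=> [n [g gP]]; pose K := (\bigcup_(i <- enum 'I_n) finsupp (g i))%fset.
have supp_K (f : direct_sum I M) i : i \notin K -> f i = 0.
  move=> iK; have [c ->] := gP f.
  rewrite (big_morph (fun f : direct_sum I M => f i)
    (fun f g => direct_sumD f g i) (direct_sum0 M i)) big1 // => j _.
  rewrite direct_sumZ fsfun_dflt ?scaler0 //; apply: contra iK.
  by apply/fsubsetP/bigfcup_sup; rewrite ?mem_enum.
pose u i : {linear M -> direct_sum K M} :=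
  if insub i is Some k then direct_sum_in M k else \0.
pose v (k : K) := direct_sum_in M (val k).
exists K; apply/isomorphicP; exists (direct_sum_out u), (direct_sum_out v).
split.
  apply: (@direct_sum_linear_eq _ _ _ _ (_ \o _) idfun) => i m.
  rewrite /= direct_sum_out_in /u; case: insubP => [k _ <-|iK].
    by rewrite direct_sum_out_in.
  have m0 : m = 0.
    by have := supp_K (direct_sum_in M i m) i iK; rewrite direct_sum_inE eqxx.
  by rewrite m0 !linear0.
apply: (@direct_sum_linear_eq _ _ _ _ (_ \o _) idfun) => k m.
by rewrite /= direct_sum_out_in direct_sum_out_in /u valK.
Qed.

End Span.

(** * Free semimodules *)

Section Free.
Variable T : pzSemiRingType.
Implicit Types M F : lSemiModType T.

Fact scale_at_lin M (x : M) : semilinear (fun a : T^o => (a : T) *: x).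
Proof. by split=> [a b|a b]; rewrite ?scalerDl // [RHS]scalerA. Qed.

Definition scale_at M (x : M) : {linear T^o -> M} := linear_of (scale_at_lin x).

(** The extension by linearity of [v] from the basis elements [direct_sum_in T^o i 1]. *)
Definition free_out (I : choiceType) M (v : I -> M) :
    {linear direct_sum I T^o -> M} := direct_sum_out (fun i => scale_at (v i)).

Lemma free_out_in (I : choiceType) M (v : I -> M) i a :
  free_out v (direct_sum_in T^o i a) = (a : T) *: v i.
Proof. exact: direct_sum_out_in. Qed.

(** Every scalar is a multiple of 1, so uniqueness on summands reduces further to the basis
    elements. *)
Lemma free_linear_eq (I : choiceType) M (u v : {linear direct_sum I T^o -> M}) :
  (forall i, u (direct_sum_in T^o i 1) = v (direct_sum_in T^o i 1)) -> u =1 v.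
Proof.
move=> uv; apply: direct_sum_linear_eq => i a.
rewrite (_ : a = a *: (1 : T^o)); last by symmetry; apply: mulr1.
by rewrite !linearZ uv.
Qed.

Lemma is_free_direct_sum (I : choiceType) F :
  is_free F -> is_free (direct_sum I F).
Proof.
case=> J /(isomorphic_direct_sum I) FJ; exists (I * J)%type.
exact: isomorphic_trans (isomorphic_direct_sum_direct_sum _ _ _).
Qed.

Lemma is_free_regular : is_free T^o.
Proof.
exists unit; apply/isomorphicP.
exists (direct_sum_in T^o tt), (free_out (fun=> 1 : T^o)); split=> [a|].
  by rewrite free_out_in; apply: mulr1.
apply: (@free_linear_eq _ _ (_ \o _) idfun) => -[] /=.
by rewrite free_out_in scale1r.
Qed.

(** A finite index set is what makes a direct sum of copies of another finitely generated semimodule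
    finitely generated again. *)
Lemma finitely_generated_is_free F : finitely_generated F -> is_free F ->
  exists K : finType, isomorphic F (direct_sum K T^o).
Proof.
move=> Ffg [I FI]; have := finitely_generated_isomorphic FI Ffg.
case/finitely_generated_direct_sum_fset=> K IK; exists K.
exact: isomorphic_trans IK.
Qed.

Lemma strongly_projective_regular : strongly_projective T^o.
Proof.
exists T^o; first exact: is_free_regular.
by apply: iso_direct_summand_isomorphic; exists idfun; exists idfun.
Qed.

Lemma fg_strongly_projective_regular : fg_strongly_projective T^o.
Proof.
exists T^o.
  by split; [exact: is_free_regular|exact: finitely_generated_regular].
by apply: iso_direct_summand_isomorphic; exists idfun; exists idfun.
Qed.

End Free.

(** * Restriction of scalars *)

Section Restriction.
Variables (R S : pzSemiRingType) (pi : {rmorphism R -> S}).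
Implicit Types B F : lSemiModType S.

Lemma restrict_scaleE B (r : R) (b : restrict pi B) :
  r *: b = (pi r *: (b : B) : B).
Proof. by []. Qed.

Fact restrict_map_lin B F (f : {linear B -> F}) :
  semilinear (f : restrict pi B -> restrict pi F).
Proof.
by split=> [r b|b c]; [rewrite restrict_scaleE; exact: linearZ|exact: linearD].
Qed.

Definition restrict_map B F (f : {linear B -> F}) :
  {linear restrict pi B -> restrict pi F} := linear_of (restrict_map_lin f).

(** Restriction keeps the underlying functions, and the biproduct equations do not mention scalars,
    so they carry over verbatim. *)
Lemma iso_direct_summand_restrict B F : iso_direct_summand B F ->
  iso_direct_summand (restrict pi B) (restrict pi F).
Proof.
case/iso_direct_summandP=> N [i1 [p1 [i2 [p2 e]]]]; apply/iso_direct_summandP.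
by exists (restrict pi N), (restrict_map i1), (restrict_map p1),
  (restrict_map i2), (restrict_map p2).
Qed.

Lemma isomorphic_restrict B F :
  isomorphic B F -> isomorphic (restrict pi B) (restrict pi F).
Proof. by case=> f fb; exists (restrict_map f). Qed.

(** Both sides have the same elements and a pointwise action through [pi], so the identity is an
    isomorphism. *)
Lemma restrict_direct_sum (I : choiceType) B :
  isomorphic (restrict pi (direct_sum I B)) (direct_sum I (restrict pi B)).
Proof.
have id_lin : semilinear (id : restrict pi (direct_sum I B) ->
    direct_sum I (restrict pi B)).
  split=> [r f|f g]; apply/fsfunP => i.
    rewrite [RHS]direct_sumZ; exact: (direct_sumZ (M := B) (pi r) f i).
  by rewrite [RHS]direct_sumD; exact: (direct_sumD (M := B) f g i).
by exists (linear_of id_lin); exists id.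
Qed.

(** Keeping [I] and [G] explicit lets this serve both the general and the finitely generated
    case. *)
Lemma iso_direct_summand_restrict_free (I : choiceType) B F :
  isomorphic F (direct_sum I S^o) -> iso_direct_summand B F ->
  forall G : lSemiModType R, iso_direct_summand (restrict pi S^o) G ->
  iso_direct_summand (restrict pi B) (direct_sum I G).
Proof.
move=> FI BF G SG; apply: iso_direct_summand_trans
  (iso_direct_summand_direct_sum I SG).
apply: iso_direct_summand_trans (iso_direct_summand_restrict BF) _.
apply/iso_direct_summand_isomorphic/(isomorphic_trans (isomorphic_restrict FI)).
exact: restrict_direct_sum.
Qed.

Lemma strongly_projective_restrict : strongly_projective (restrict pi S^o) ->
  forall B, strongly_projective B -> strongly_projective (restrict pi B).
Proof.
move=> [G Gfree SG] B [F [I FI] BF]; exists (direct_sum I G).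
  exact: is_free_direct_sum.
exact: iso_direct_summand_restrict_free FI BF G SG.
Qed.

Lemma fg_strongly_projective_restrict :
  fg_strongly_projective (restrict pi S^o) ->
  forall B, fg_strongly_projective B -> fg_strongly_projective (restrict pi B).
Proof.
move=> [G [Gfree Gfg] SG] B [F [Ffree Ffg] BF].
have [K FK] := finitely_generated_is_free Ffg Ffree.
exists (direct_sum K G).
  by split; [exact: is_free_direct_sum|exact: finitely_generated_direct_sum].
exact: iso_direct_summand_restrict_free FK BF G SG.
Qed.

End Restriction.

(** * Extension of scalars *)

Section Extension.
Variables (R S : pzSemiRingType) (pi : {rmorphism R -> S}).
Implicit Types A F : rSemiModType R.

(** * Extension as left adjoint of restriction *)

Section Adjunction.
Variable A : rSemiModType R.

Lemma extension_scaleE a (s : S) (t : S^c) :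
  t *: (@tens R A (restrict pi S^o) a s : extension pi A) =
  @tens R A (restrict pi S^o) a (s * (t : S)).
Proof. exact: extension_scale_tens. Qed.

(** The unit of the adjunction. Balancing gives (a r) (x) 1 = a (x) pi r = (a (x) 1) pi r. *)
Fact extension_unit_lin : semilinear (fun a : A =>
  @tens R A (restrict pi S^o) a (1 : S) : restriction pi (extension pi A)).
Proof.
split=> [r a|a b]; last exact: tensDl.
rewrite restrict_scaleE extension_scaleE tens_bal; congr tens.
by rewrite mul1r; apply: mulr1.
Qed.

Definition extension_unit : {linear A -> restriction pi (extension pi A)} :=
  linear_of extension_unit_lin.

Lemma extension_tensE a (s : S) :
  @tens R A (restrict pi S^o) a s =
  (s : S^c) *: (extension_unit a : extension pi A).
Proof. by rewrite extension_scaleE mul1r. Qed.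

(** Since a (x) s = (a (x) 1) s, the image of the unit generates the extension over [S]. *)
Lemma extension_unit_ind (P : extension pi A -> Prop) :
  P 0 -> (forall x y, P x -> P y -> P (x + y)) ->
  (forall (s : S^c) a, P (s *: (extension_unit a : extension pi A))) ->
  forall x, P x.
Proof.
move=> P0 PD Pt; apply: extension_ind => // a s.
by rewrite extension_tensE; apply: Pt.
Qed.

Section Out.
Variables (V : rSemiModType S) (f : {linear A -> restriction pi V}).

(** The transpose of [f], sending a (x) s to (f a) s. The five local facts after it are the
    conditions under which [tensor_lift] respects the tensor congruence. *)
Definition extension_out_fun : extension pi A -> V :=
  tensor_lift (fun a (s : restrict pi S^o) => (s : S^c) *: (f a : V)).

Let fDl a1 a2 (s : restrict pi S^o) :
  (s : S^c) *: (f (a1 + a2) : V) =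
  (s : S^c) *: (f a1 : V) + (s : S^c) *: (f a2 : V).
Proof. by rewrite linearD; apply: scalerDr. Qed.

Let fDr a (s1 s2 : restrict pi S^o) :
  ((s1 + s2 : restrict pi S^o) : S^c) *: (f a : V) =
  (s1 : S^c) *: (f a : V) + (s2 : S^c) *: (f a : V).
Proof. exact: scalerDl. Qed.

Let f_bal a (r : R) (s : restrict pi S^o) :
  (s : S^c) *: (f ((r : R^c) *: a) : V) =
  ((r *: s : restrict pi S^o) : S^c) *: (f a : V).
Proof. by rewrite linearZ; apply: scalerA. Qed.

Let f0l (s : restrict pi S^o) : (s : S^c) *: (f 0 : V) = 0.
Proof. by rewrite linear0; apply: scaler0. Qed.

Let f0r a : ((0 : restrict pi S^o) : S^c) *: (f a : V) = 0.
Proof. exact: scale0r. Qed.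

Fact extension_out_lin : semilinear extension_out_fun.
Proof.
have outD : {morph extension_out_fun : x y / x + y}.
  exact: tensor_liftD fDl fDr f_bal f0l f0r.
have out0 : extension_out_fun 0 = 0 by exact: tensor_lift0 fDl fDr f_bal f0l f0r.
split=> // t x; elim/extension_ind: x => [|x y ex ey|a s].
- by rewrite scaler0 out0 scaler0.
- by rewrite scalerDr !outD ex ey scalerDr.
- rewrite extension_scaleE /extension_out_fun.
  rewrite !(tensor_lift_tens fDl fDr f_bal f0l f0r).
  by rewrite scalerA.
Qed.

Definition extension_out : {linear extension pi A -> V} :=
  linear_of extension_out_lin.

Lemma extension_out_unit a : extension_out (extension_unit a) = f a.
Proof.
have -> : extension_out (extension_unit a) = (1 : S^c) *: (f a : V).
  exact: tensor_lift_tens fDl fDr f_bal f0l f0r _ _.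
exact: scale1r.
Qed.

End Out.

(** The uniqueness half of the adjunction: identities of maps on an extension are checked on the
    elements a (x) 1. *)
Lemma extension_linear_eq (V : rSemiModType S)
    (u v : {linear extension pi A -> V}) :
  (forall a, u (extension_unit a) = v (extension_unit a)) -> u =1 v.
Proof.
move=> uv; elim/extension_unit_ind => [|x y ex ey|s a].
- by rewrite !linear0.
- by rewrite !linearD ex ey.
- by rewrite !linearZ uv.
Qed.

End Adjunction.

(** This is f (x) id, obtained as the transpose of [f] followed by the unit. *)
Definition extension_map A F (f : {linear A -> F}) :
    {linear extension pi A -> extension pi F} :=
  extension_out (extension_unit F \o f).

Lemma extension_map_unit A F (f : {linear A -> F}) a :
  extension_map f (extension_unit A a) = extension_unit F (f a).
Proof. exact: extension_out_unit. Qed.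

Lemma extension_mapK A F (f : {linear A -> F}) (g : {linear F -> A}) :
  cancel f g -> cancel (extension_map f) (extension_map g).
Proof.
move=> fK; apply: (@extension_linear_eq _ _ (_ \o _) idfun) => a.
by rewrite /= !extension_map_unit fK.
Qed.

Lemma isomorphic_extension A F :
  isomorphic A F -> isomorphic (extension pi A) (extension pi F).
Proof.
case/isomorphicP=> f [g [fK gK]]; apply/isomorphicP.
by exists (extension_map f), (extension_map g); split; apply: extension_mapK.
Qed.

Lemma iso_direct_summand_extension A F : iso_direct_summand A F ->
  iso_direct_summand (extension pi A) (extension pi F).
Proof.
case/iso_direct_summandP=> N [i1 [p1 [i2 [p2 [e11 e22 e21 e12 e]]]]].
apply/iso_direct_summandP; exists (extension pi N), (extension_map i1),
  (extension_map p1), (extension_map i2), (extension_map p2).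
split; try exact: extension_mapK.
- apply: (@extension_linear_eq _ _ (_ \o _) \0) => a.
  by rewrite /= !extension_map_unit e21 linear0.
- apply: (@extension_linear_eq _ _ (_ \o _) \0) => a.
  by rewrite /= !extension_map_unit e12 linear0.
- apply: (@extension_linear_eq _ _ ((_ \o _) \+ (_ \o _)) idfun) => a.
  by rewrite /= !extension_map_unit -[in RHS](e a) linearD.
Qed.

Lemma is_free_extension A : is_free A -> is_free (extension pi A).
Proof.
case=> I /isomorphic_extension AI; exists I; apply: isomorphic_trans AI _.
(* [e T i] is the basis element e_i over [T]. The map [u] sends e_i (x) 1 to e_i, and [v] sends e_i
   back to e_i (x) 1. *)
pose e T i := direct_sum_in (T^o : lSemiModType T) (i : I) 1.
pose u := extension_out (free_out (fun i => e S^c i : restriction pi _)).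
pose v := free_out (fun i => extension_unit _ (e R^c i) : extension pi _).
apply/isomorphicP; exists u, v; split.
  apply: (@extension_linear_eq _ _ (_ \o _) idfun) => f.
  rewrite /= /u extension_out_unit.
  (* On elements f (x) 1 both sides are linear over [R^c] in [f], once [v] is restricted along [pi];
     hence it suffices to take basis elements for [f]. *)
  apply: (@free_linear_eq _ _ _ (restrict_map _ v \o _) (extension_unit _)) => i.
  by rewrite /= free_out_in scale1r; rewrite [LHS]free_out_in scale1r.
apply: (@free_linear_eq _ _ _ (_ \o _) idfun) => i.
by rewrite /= free_out_in scale1r /u extension_out_unit free_out_in scale1r.
Qed.

Lemma finitely_generated_extension A :
  finitely_generated A -> finitely_generated (extension pi A).
Proof.
move=> /finitely_generatedP[X [g gP]]; apply/finitely_generatedP.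
exists X, (fun i => extension_unit A (g i)).
elim/extension_unit_ind => [|x y|s a].
- exact: in_span0.
- exact: in_spanD.
(* If [a] is the sum of the g_i c_i, then a (x) 1 is the sum of the (g_i (x) 1) pi(c_i). *)
- apply: in_spanZ; have [c ->] := gP a; exists (fun i => rmorph_converse pi (c i)).
  by rewrite linear_sum; apply: eq_bigr => i _; rewrite linearZ.
Qed.

Lemma strongly_projective_extension A :
  strongly_projective A -> strongly_projective (extension pi A).
Proof.
case=> F /is_free_extension Ffree /iso_direct_summand_extension AF.
by exists (extension pi F).
Qed.

Lemma fg_strongly_projective_extension A :
  fg_strongly_projective A -> fg_strongly_projective (extension pi A).
Proof.
case=> F [/is_free_extension Ffree /finitely_generated_extension Ffg].
by move=> /iso_direct_summand_extension AF; exists (extension pi F).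
Qed.

End Extension.

Theorem proposition4p8 (R S : pzSemiRingType) (pi : {rmorphism R -> S}) :
  ((forall A : rSemiModType R,
      strongly_projective A -> strongly_projective (extension pi A)) /\
   (forall A : rSemiModType R,
      fg_strongly_projective A -> fg_strongly_projective (extension pi A))) /\
  (((forall B : rSemiModType S,
       strongly_projective B -> strongly_projective (restriction pi B)) <->
    strongly_projective (restriction pi (rregular S))) /\
   ((forall B : rSemiModType S,
       fg_strongly_projective B ->
       fg_strongly_projective (restriction pi B)) <->
    fg_strongly_projective (restriction pi (rregular S)))).
Proof.
split; split.
- exact: strongly_projective_extension.
- exact: fg_strongly_projective_extension.
(* [restriction pi] is restriction along [rmorph_converse pi], so the results on [restrict] apply
   over the converse semirings. Conversely, [rregular S] is itself strongly projective, so the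
   assumed preservation applies to it. *)
- split=> [|SR B]; last exact: strongly_projective_restrict.
  by apply; apply: strongly_projective_regular.
- split=> [|SR B]; last exact: fg_strongly_projective_restrict.
  by apply; apply: fg_strongly_projective_regular.
Qed.
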